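(* Let $\underline F$ be a fragment of length $\ell\ge2$ and let $i$ be an index with $0\le i\le\ell-2$ at which $\underline F$ exhibits a cross, i.e. $F_i^\uparrow=F_i^\downarrow=\mathrm{Dom}_{i+1}(\underline F)$. Set $\delta_{i-1}=1$ if $F_{i-1}^\uparrow\sim F_{i-1}^\downarrow$ and $\delta_{i-1}=0$ otherwise. Then: (i) every $\underline w=(w_0,\dots,w_{\ell-1})\in\mathcal W(\underline F)$ satisfies $w_i=0$; (ii) for $w_0,\dots,w_{\ell-2}\in\{0,1\}$, we have $(w_0,\dots,w_{\ell-2})\in\mathcal W(\underline F^{(i)})$ if and only if $(w_0,\dots,w_{i-1},0,w_i,\dots,w_{\ell-2})\in\mathcal W(\underline F)$ and $(w_{i-1},w_i)\neq(\delta_{i-1},1)$, where $\underline F^{(i)}=(F_0,\dots,F_{i-1},F_{i+1},\dots,F_{\ell-1})$ is obtained by deleting the $i$-th column.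
   Context: Fragments. A fragment of length $\ell\ge1$ is a tuple $\underline F=(F_0,\dots,F_{\ell-1})$ of pairs $F_i=(F_i^\uparrow,F_i^\downarrow)\in\{\mathbf{A},\mathbf{B},\mathbf{AB},\mathbf{0}\}^2$ (formal symbols) such that: exactly one of $F_0^\uparrow,F_0^\downarrow$ equals $\mathbf{0}$; for $i>0$, $F_i^\uparrow,F_i^\downarrow\ne\mathbf 0$; for $i<\ell-1$, $F_i^\uparrow,F_i^\downarrow\ne\mathbf{AB}$; if $\ell>1$, exactly one of $F_{\ell-1}^\uparrow,F_{\ell-1}^\downarrow$ equals $\mathbf{AB}$. Dominant letter (for $\ell\ge2$). The letter $\mathbf A$ occurs in the symbols $\mathbf A$ and $\mathbf{AB}$, the letter $\mathbf B$ in $\mathbf B$ and $\mathbf{AB}$. For $0\le j\le\ell-1$, $\mathrm{Dom}_j(\underline F)\in\{\mathbf A,\mathbf B\}$ is the letter occurring more often than the other one among the two entries $F_j^\uparrow,F_j^\downarrow$, and if they occur equally often, $\mathrm{Dom}_j(\underline F)=\mathrm{Dom}_{j+1}(\underline F)$. Fragmentary weights. Let $\sim$ be the equivalence relation on symbols with classes $\{\mathbf{A},\mathbf{AB}\}$ and $\{\mathbf{B},\mathbf{0}\}$. For a set $W$ of tuples and $c\in\{0,1\}$, $W\times\{c\}$ is the set of tuples obtained by appending $c$. For a tuple $\underline F=(F_0,\dots,F_{\ell-1})$ of pairs of symbols define $W_i^{(b,b)},W_i^{(a,b)},W_i^{(b,a)}\subset\{0,1\}^{i+1}$: $W_0^{(b,b)}=\emptyset$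 if $\ell=1$ and ($F_0^\uparrow\in\{\mathbf A,\mathbf B\}$ or $F_0^\downarrow\in\{\mathbf A,\mathbf B\}$), else $\{(1)\}$; $W_0^{(a,b)}=\emptyset$ if $F_0^\downarrow=\mathbf 0$, else $\{(0)\}$; $W_0^{(b,a)}=\emptyset$ if $F_0^\uparrow=\mathbf 0$, else $\{(0)\}$; for $1\le i\le\ell-1$: $W_i^{(b,b)}=(W_{i-1}^{(a,b)}\cup W_{i-1}^{(b,a)})\times\{1\}$ if $F_{i-1}^\uparrow\sim F_{i-1}^\downarrow$, else $W_{i-1}^{(b,b)}\times\{1\}$; $W_i^{(a,b)}=W_{i-1}^{(a,b)}\times\{0\}$ if $F_i^\uparrow\sim F_{i-1}^\uparrow$, else $(W_{i-1}^{(b,a)}\cup W_{i-1}^{(b,b)})\times\{0\}$; $W_i^{(b,a)}=W_{i-1}^{(b,a)}\times\{0\}$ if $F_i^\downarrow\sim F_{i-1}^\downarrow$, else $(W_{i-1}^{(a,b)}\cup W_{i-1}^{(b,b)})\times\{0\}$. Then $\mathcal W(\underline F)=W_{\ell-1}^{(b,b)}\cup W_{\ell-1}^{(a,b)}$ if $F_{\ell-1}^\downarrow=\mathbf{AB}$; $=W_{\ell-1}^{(b,b)}\cup W_{\ell-1}^{(b,a)}$ if $F_{\ell-1}^\uparrow=\mathbf{AB}$; $=W_0^{(b,b)}\cup W_0^{(a,b)}\cup W_0^{(b,a)}$ otherwise. *)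

(* Defs.v *)
From HB Require Import structures.
From mathcomp Require Import all_boot finmap.

Set Implicit Arguments.
Unset Strict Implicit.
Unset Printing Implicit Defensive.

Inductive symbol : Type := SymA | SymB | SymAB | Sym0.

Definition symbol_eqb (s t : symbol) : bool :=
  match s, t with
  | SymA, SymA | SymB, SymB | SymAB, SymAB | Sym0, Sym0 => true
  | _, _ => false
  end.

Lemma symbol_eqP : Equality.axiom symbol_eqb.
Proof. by case; case; constructor. Qed.

HB.instance Definition _ := hasDecEq.Build symbol symbol_eqP.

(* A column (F^up, F^down). A tuple of columns is a sequence F, its length is
   size F; a tuple in {0,1}^n is a seq bool of size n (0 = false, 1 = true). *)
Notation column := (symbol * symbol)%type.

(* The default value of nth is only reached at indices j >= size F. *)
Definition up (F : seq column) (j : nat) : symbol := (nth (Sym0, Sym0) F j).1.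
Definition down (F : seq column) (j : nat) : symbol := (nth (Sym0, Sym0) F j).2.

Definition is_fragment (F : seq column) : Prop :=
  let l := size F in
  [/\ 1 <= l,
      (up F 0 == Sym0) (+) (down F 0 == Sym0),
      forall j, 0 < j < l -> up F j != Sym0 /\ down F j != Sym0,
      forall j, j < l.-1 -> up F j != SymAB /\ down F j != SymAB
    & 1 < l -> (up F l.-1 == SymAB) (+) (down F l.-1 == SymAB)].

Definition occursA (s : symbol) : bool := s \in [:: SymA; SymAB].
Definition occursB (s : symbol) : bool := s \in [:: SymB; SymAB].

(* For a fragment of length >= 2, one of the letters is strictly more frequent
   in the last column, so the value Sym0 on the empty sequence is not reached
   by dom F j with j < size F. *)
Fixpoint dom_seq (s : seq column) : symbol :=
  if s is c :: s' then
    let a := occursA c.1 + occursA c.2 in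
    let b := occursB c.1 + occursB c.2 in
    if b < a then SymA else if a < b then SymB else dom_seq s'
  else Sym0.

Definition dom (F : seq column) (j : nat) : symbol := dom_seq (drop j F).

Definition cross (F : seq column) (i : nat) : Prop :=
  up F i = dom F i.+1 /\ down F i = dom F i.+1.

(* The equivalence relation with classes {A, AB} and {B, 0} *)
Definition sim (s t : symbol) : bool :=
  (s \in [:: SymA; SymAB]) == (t \in [:: SymA; SymAB]).

Local Open Scope fset_scope.

Definition append (W : {fset seq bool}) (c : bool) : {fset seq bool} :=
  [fset rcons w c | w in W].

Fixpoint Wbb (F : seq column) (i : nat) : {fset seq bool} :=
  match i with
  | 0 => if (size F == 1)
            && ((up F 0 \in [:: SymA; SymB]) || (down F 0 \in [:: SymA; SymB]))
         then fset0 else [fset [:: true]]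
  | j.+1 => if sim (up F j) (down F j)
            then append (Wab F j `|` Wba F j) true
            else append (Wbb F j) true
  end
with Wab (F : seq column) (i : nat) : {fset seq bool} :=
  match i with
  | 0 => if down F 0 == Sym0 then fset0 else [fset [:: false]]
  | j.+1 => if sim (up F j.+1) (up F j)
            then append (Wab F j) false
            else append (Wba F j `|` Wbb F j) false
  end
with Wba (F : seq column) (i : nat) : {fset seq bool} :=
  match i with
  | 0 => if up F 0 == Sym0 then fset0 else [fset [:: false]]
  | j.+1 => if sim (down F j.+1) (down F j)
            then append (Wba F j) false
            else append (Wab F j `|` Wbb F j) false
  end.

Definition weights (F : seq column) : {fset seq bool} :=
  let m := (size F).-1 in
  if down F m == SymAB then Wbb F m `|` Wab F m
  else if up F m == SymAB then Wbb F m `|` Wba F m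
  else Wbb F 0 `|` Wab F 0 `|` Wba F 0.

Definition delete_at (T : Type) (i : nat) (s : seq T) : seq T :=
  take i s ++ drop i.+1 s.

Definition insert_at (T : Type) (i : nat) (x : T) (s : seq T) : seq T :=
  take i s ++ x :: drop i s.

(* delta F j is delta_j; the statement uses it at j = i - 1 for a cross i,
   which is positive by cross_gt0. *)
Definition delta (F : seq column) (j : nat) : bool := sim (up F j) (down F j).

Lemma cross_gt0 (F : seq column) (i : nat) :
  is_fragment F -> cross F i -> 0 < i.
Proof.
case: i => // -[_ F0 _ _ _] [uF dF].
by move: F0; rewrite uF dF addbb.
Qed.

Lemma size_W (F : seq column) (i : nat) (w : seq bool) :
  w \in Wbb F i `|` Wab F i `|` Wba F i -> size w = i.+1.
Proof.
elim: i w => [|i IH] w; rewrite !in_fsetU /=.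
  by do 3![case: ifP => _]; rewrite ?in_fset1 ?in_fset0 ?orbF //=;
     do ?[case/orP]; move=> /eqP ->.
have size_append c (W : {fset seq bool}) :
    W `<=` Wbb F i `|` Wab F i `|` Wba F i -> w \in append W c ->
    size w = i.+2.
  by move=> /fsubsetP sW /imfsetP[/= v /sW /IH sv ->]; rewrite size_rcons sv.
by do 3![case: ifP => _]; do ?[case/orP];
   apply: size_append; apply/fsubsetP => v; rewrite !in_fsetU;
   do ?[case/orP]; move=> ->; rewrite ?orbT.
Qed.

Lemma size_weights (F : seq column) (w : seq bool) :
  is_fragment F -> w \in weights F -> size w = size F.
Proof.
case=> l0 _ _ _ lAB wF.
have W_w : w \in Wbb F (size F).-1 `|` Wab F (size F).-1 `|` Wba F (size F).-1.
  move: wF; rewrite /weights; case: ifP => [_|dF].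
    by rewrite !in_fsetU => ->.
  case: ifP => [_|uF].
    by rewrite !in_fsetU => /orP[->|->] //; rewrite orbT.
  move: l0; rewrite leq_eqVlt => /predU1P[<- //|/lAB].
  by rewrite dF uF.
by rewrite (size_W W_w) prednK.
Qed.

(* Main.v *)
(** Membership of a word [w] in [weights F] is decided by a three-state
    automaton: after column [j], record which of the sets [Wbb], [Wab], [Wba]
    contain the prefix of [w] of length [j + 1].  Only the classes of the
    symbols modulo [sim] matter for the transitions.

    Let [d] be the dominant letter of the columns from [j] on.  Then the state
    [ab] is useless at column [j] unless its upper symbol has the class of [d],
    and likewise for [ba] and the lower symbol: until the tie is broken, every
    column contains the two letters once each, and such a useless state can
    only move to another useless state.  Hence two automaton states that differ
    only by useless components accept the same words.  At a cross, the letter 1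
    leads only to useless components, which gives (i), and reading the letter 0
    on the crossed column before the next column has, up to useless components,
    the same effect as skipping that column, except when
    [(w_(i-1), w_i) = (delta_(i-1), 1)], where the automaton of the shortened
    fragment is stuck: this gives (ii). *)
Require Import Defs.
From mathcomp Require Import all_boot finmap.
From mathcomp Require Import zify.

Set Implicit Arguments.
Unset Strict Implicit.
Unset Printing Implicit Defensive.

Local Open Scope fset_scope.

(* The components stand for (b,b), (a,b) and (b,a), in this order. *)
Definition state := (bool * bool * bool)%type.

Definition col (F : seq column) (j : nat) : column := nth (Sym0, Sym0) F j.

Definition step (c c' : column) (b : bool) (s : state) : state :=
  let: (bb, ab, ba) := s in
  (b && (if sim c.1 c.2 then ab || ba else bb),
   ~~ b && (if sim c'.1 c.1 then ab else ba || bb),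
   ~~ b && (if sim c'.2 c.2 then ba else ab || bb)).

Definition final (c : column) (s : state) : bool :=
  let: (bb, ab, ba) := s in
  if c.2 == SymAB then bb || ab else if c.1 == SymAB then bb || ba else false.

Fixpoint accepts (c : column) (s : state) (S : seq column) (v : seq bool) :=
  match S, v with
  | c' :: S', b :: v' => accepts c' (step c c' b s) S' v'
  | _, _ => final c s
  end.

Definition stuck : state := (false, false, false).

Definition reach (F : seq column) (w : seq bool) (j : nat) : state :=
  (take j.+1 w \in Wbb F j, take j.+1 w \in Wab F j, take j.+1 w \in Wba F j).

(** Words of [Wbb] end in 1 and those of [Wab] and [Wba] in 0, so the last letter [b] restricts the
    state. *)
Definition consistent (b : bool) (s : state) : bool :=
  let: (bb, ab, ba) := s in (bb ==> b) && ((ab || ba) ==> ~~ b).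

(** Equality up to useless components, [d] being the dominant letter from column [c] on. *)
Definition agree (d : symbol) (c : column) (s t : state) : bool :=
  [&& s.1.1 == t.1.1, sim c.1 d ==> (s.1.2 == t.1.2)
    & sim c.2 d ==> (s.2 == t.2)].

Definition letter (x : symbol) : bool := x \in [:: SymA; SymB].

(** The fragment conditions on a suffix that avoids column 0, in a form suited to induction. *)
Fixpoint fragment_tail (S : seq column) : bool :=
  match S with
  | [::] => false
  | [:: c] => (c.1 == SymAB) && letter c.2 || letter c.1 && (c.2 == SymAB)
  | c :: S' => [&& letter c.1, letter c.2 & fragment_tail S']
  end.

(** * Weights as runs of the automaton *)

Lemma mem_append (W : {fset seq bool}) (c b : bool) (v : seq bool) :
  (rcons v b \in append W c) = (b == c) && (v \in W).
Proof.
apply/imfsetP/andP => [[/= u uW /rcons_inj[-> ->]]|[/eqP-> vW]] //.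
by exists v.
Qed.

Lemma reachS F w j : j.+1 < size w ->
  reach F w j.+1 = step (col F j) (col F j.+1) (nth false w j.+1) (reach F w j).
Proof.
move=> jw; rewrite /reach (take_nth false jw) /= /up /down -/(col F j).
rewrite -/(col F j.+1).
by do 3![case: ifP => _]; rewrite !mem_append ?in_fsetU eqb_id eqbF_neg.
Qed.

Lemma consistent_reach F w j :
  j < size w -> consistent (nth false w j) (reach F w j).
Proof.
case: j => [|j] jw; last first.
  by rewrite reachS //; case: (reach _ _ _) => [[[] []] []];
     case: (nth _ _ _) => //=; do ?case: ifP.
case: w jw => // b w _; rewrite /reach /= take0.
by do 3![case: ifP => _]; rewrite ?in_fset1 ?in_fset0; case: b.
Qed.

(** The length enters these sets only through the test for length 1 in [Wbb] at index 0. *)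
Lemma eq_W (F G : seq column) (j : nat) :
  (size F == 1) = (size G == 1) -> (forall k, k <= j -> col F k = col G k) ->
  [/\ Wbb F j = Wbb G j, Wab F j = Wab G j & Wba F j = Wba G j].
Proof.
move=> sFG; elim: j => [|j IH] FG /=; rewrite /up /down -!/(col _ _).
  by rewrite sFG FG.
have [k kj|-> -> ->] := IH; first exact: FG (leqW kj).
by rewrite !FG.
Qed.

Lemma eq_reach (F G : seq column) (w v : seq bool) (j : nat) :
  (size F == 1) = (size G == 1) -> (forall k, k <= j -> col F k = col G k) ->
  take j.+1 w = take j.+1 v -> reach F w j = reach G v j.
Proof. by move=> sFG FG wv; case: (eq_W sFG FG); rewrite /reach wv => -> -> ->. Qed.

Lemma accepts_reachS F w j : size w = size F -> j.+1 < size F ->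
  accepts (col F j) (reach F w j) (drop j.+1 F) (drop j.+1 w) =
  accepts (col F j.+1) (reach F w j.+1) (drop j.+2 F) (drop j.+2 w).
Proof.
move=> sw jF; have jw : j.+1 < size w by rewrite sw.
by rewrite (drop_nth (Sym0, Sym0) jF) (drop_nth false jw) /= reachS.
Qed.

Lemma mem_weightsE F w j :
  fragment_tail (drop (size F).-1 F) -> size w = size F -> j < size F ->
  (w \in weights F) =
  accepts (col F j) (reach F w j) (drop j.+1 F) (drop j.+1 w).
Proof.
move=> Ftail sw jF; have F0 : 0 < size F by apply: leq_trans jF.
have [k] : {k | k = (size F).-1 - j} by exists ((size F).-1 - j).
elim: k j jF => [|k IH] j jF kE; last first.
  have jF1 : j.+1 < size F by rewrite -ltn_predRL -subn_gt0 -kE.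
  by rewrite accepts_reachS // -IH // subnS -kE.
have jE : j = (size F).-1.
  apply/eqP; rewrite eqn_leq -ltnS prednK // jF /=.
  by rewrite -subn_eq0 -kE.
have dropF : drop (size F).-1 F = [:: col F (size F).-1].
  by rewrite (drop_nth (Sym0, Sym0)) ?prednK // drop_size.
rewrite {}jE prednK // drop_size /= /weights /reach prednK // -sw take_size sw.
move: Ftail; rewrite dropF /= /up /down -!/(col _ _).
case: (col F (size F).-1) => x y /=.
by case: ifP => _; rewrite ?in_fsetU //; case: ifP => _ //; rewrite ?in_fsetU ?andbF.
Qed.

(** * Suffixes of fragments *)

Lemma tail_of_fragment F j : is_fragment F -> 0 < j < size F ->
  fragment_tail (drop j F).
Proof.
case=> F0 _ Fn0 FnAB FAB /andP[j0 jF].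
have [k] : {k | k = (size F).-1 - j} by exists ((size F).-1 - j).
elim: k j j0 jF => [|k IH] j j0 jF kE; rewrite (drop_nth (Sym0, Sym0) jF) /=.
  have jE : j = (size F).-1.
    apply/eqP; rewrite eqn_leq -ltnS prednK // jF /=.
    by rewrite -subn_eq0 -kE.
  have F1 : 1 < size F by apply: leq_ltn_trans jF.
  rewrite drop_oversize ?jE ?prednK //.
  have [] := Fn0 (size F).-1; first by rewrite -jE j0 jF.
  move: (FAB F1); rewrite /up /down.
  by case: (nth _ F (size F).-1) => [[] []].
have jF1 : j < (size F).-1 by rewrite -subn_gt0 -kE.
have jF1' : j.+1 < size F by rewrite -ltn_predRL.
have [|u0 d0] := Fn0 j; first by rewrite j0 jF.
have [uAB dAB] := FnAB j jF1.
move: (IH j.+1 isT jF1'); rewrite subnS -kE => /(_ erefl).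
case: (drop j.+1 F) => // c S ->; rewrite /letter.
by move: u0 d0 uAB dAB; rewrite /up /down; case: (nth _ F j) => [[] []].
Qed.

Lemma dom_fragment_tail S : fragment_tail S -> letter (dom_seq S).
Proof.
elim: S => // -[x y] [|c S] IH; first by case: x y => [] [].
case/and3P=> /= lx ly /IH lS.
by case: x y lx ly => [] [] //= _ _; rewrite ?ltnn.
Qed.

(** * Irrelevance of useless components *)

Lemma accepts_stuck c S v : accepts c stuck S v = false.
Proof.
elim: S c v => [|c' S IH] c [|b v] /=; do ?by do ?case: ifP.
by rewrite !if_same !andbF IH.
Qed.

(** Besides (b,b), [final] reads only the component of the entry opposite [SymAB], and that entry is
    the dominant letter. *)
Lemma final_agree c s t : fragment_tail [:: c] ->
  agree (dom_seq [:: c]) c s t -> final c s = final c t.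
Proof.
by case: c => [[] []] //=; move: s t => [[[] []] []] [[[] []] []].
Qed.

(** Exactly one entry of [c] is [d]. The useless component is passed on only to entries of [c']
    outside the class of [d], where it is useless again. *)
Lemma step_agree c c' b d s t : letter c.1 -> letter c.2 -> letter d ->
  ~~ sim c.1 c.2 -> agree d c s t -> agree d c' (step c c' b s) (step c c' b t).
Proof.
case: c c' => [x y] [x' y']; rewrite /agree /step /sim /=.
case: (x' \in _) (y' \in _) => [] []; case: x => //; case: y => //; case: d => //;
by case: b; move: s t => [[[] []] []] [[[] []] []].
Qed.

Lemma agree_eq d c s t : sim c.1 d -> sim c.2 d -> agree d c s t -> s = t.
Proof.
by move: s t => [[? ?] ?] [[? ?] ?] /= + +; rewrite /agree => -> -> /=
   /and3P[/eqP-> /eqP-> /eqP->].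
Qed.

Lemma accepts_agree c S v s t :
  fragment_tail (c :: S) -> agree (dom_seq (c :: S)) c s t ->
  accepts c s S v = accepts c t S v.
Proof.
elim: S c v s t => [|c' S IH] c v s t Stail st.
  by case: v => [|b v]; apply: final_agree st.
have [lx ly S'tail] := and3P Stail.
have [xy|xy] := boolP (sim c.1 c.2).
  (* Similar letters are equal, so both entries are the dominant letter and no component is
     useless. *)
  suff -> : s = t by [].
  by case: c lx ly xy st {Stail} => [[] []] //= _ _ _ /agree_eq->.
have domE : dom_seq [:: c, c' & S] = dom_seq (c' :: S).
  by case: c lx ly xy {st Stail} => [[] []].
case: v => [|b v] /=.
  (* A word that ends too early is rejected, since no entry of [c] is [SymAB]. *)
  by case: c lx ly {Stail xy st domE} => [[] []] //=; case: s t => [[? ?] ?] [[? ?] ?].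
apply: IH => //; apply: step_agree => //; first exact: dom_fragment_tail.
by rewrite -domE.
Qed.

(** * Passing a cross *)

(** Only (b,b) can hold after the letter 1, and a cross passes it on only to entries of [c'] outside
    the class of [d]. *)
Lemma step_cross_true c c' d s :
  c = (d, d) -> consistent true s -> forall b, agree d c' (step c c' b s) stuck.
Proof.
move=> -> + b; case: c' => x y; rewrite /agree /step /sim /=.
case: (x \in _) (y \in _) (d \in _) => [] [] [];
by case: b; move: s => [[[] []] []].
Qed.

(** For [v = 0], an entry of [c'] in the class of [d] inherits through the cross what it would
    receive from [p]. For [v = 1], the cross collects in (a,b) and (b,a) what [p] would pass to
    (b,b). *)
Lemma step_skip_cross p c c' d b v s :
  c = (d, d) -> consistent b s -> (b, v) <> (sim p.1 p.2, true) ->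
  agree d c' (step p c' v s) (step c c' v (step p c false s)).
Proof.
move=> -> + /eqP; case: p c' => [x y] [x' y'].
rewrite /agree /step /sim xpair_eqE /=.
case: (x \in _) (y \in _) (x' \in _) (y' \in _) (d \in _) => [] [] [] [] [];
by case: b; case: v; move: s => [[[] []] []].
Qed.

(** The components that the letter 1 reads at [p] are those that the letter [b] has emptied. *)
Lemma step_exceptional p c b s :
  consistent b s -> b = sim p.1 p.2 -> step p c true s = stuck.
Proof. by move=> + bE; rewrite /step -bE; case: b {bE}; move: s => [[[] []] []]. Qed.

Theorem theorem3p3p1 (F : seq column) (i : nat)
    (F_fragment : is_fragment F) (F_length : 2 <= size F)
    (i_le : i <= size F - 2) (F_cross : cross F i) :
  (forall w : seq bool, w \in weights F -> nth false w i = false) /\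
  (forall w : seq bool, size w = size F - 1 ->
     (w \in weights (delete_at i F) <->
      insert_at i false w \in weights F /\
      (nth false w (i - 1), nth false w i) <> (delta F (i - 1), true))).
Proof.
have i0 := cross_gt0 F_fragment F_cross.
have iF1 : i.+1 < size F by lia.
have iF := ltnW iF1.
have dropF : drop i.+1 F = col F i.+1 :: drop i.+2 F by apply: drop_nth.
have tailF : fragment_tail (col F i.+1 :: drop i.+2 F).
  by rewrite -dropF; apply: tail_of_fragment; rewrite ?iF1.
have domF : dom F i.+1 = dom_seq (col F i.+1 :: drop i.+2 F) by rewrite -dropF.
have colF : col F i = (dom F i.+1, dom F i.+1).
  by case: F_cross; rewrite /up /down -/(col F i); case: (col F i) => x y /= -> ->.
have lastF : fragment_tail (drop (size F).-1 F).
  by apply: tail_of_fragment => //; lia.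
split=> [w wF|w sw].
  have sw := size_weights F_fragment wF.
  have sw1 : i.+1 < size w by rewrite sw.
  apply/negbTE/negP => wi; move: wF.
  have cons := consistent_reach F (ltnW sw1); rewrite wi in cons.
  rewrite (mem_weightsE lastF sw iF1) reachS //.
  rewrite (@accepts_agree _ _ _ _ stuck tailF) ?accepts_stuck //.
  by rewrite -domF; apply: step_cross_true colF cons _.
(* From here on the cross is column [i.+1], and [i] is the column before it. *)
case: i i0 {i_le F_cross} iF1 iF dropF tailF domF colF => // i _ iF1 iF.
move=> dropF tailF domF colF; rewrite subSS subn0.
set w' := insert_at _ _ _; set F' := delete_at _ _.
have sizew : i.+1 < size w by lia.
have sizetF : size (take i.+1 F) = i.+1 by rewrite size_takel // ltnW.
have sizetw : size (take i.+1 w) = i.+1 by rewrite size_takel // ltnW.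
have sizeF' : size F' = (size F).-1.
  by rewrite size_cat sizetF size_drop; lia.
have sizew' : size w' = size F.
  by rewrite size_cat sizetw /= size_drop; lia.
have colF' k : k <= i -> col F' k = col F k.
  by move=> ki; rewrite /col nth_cat sizetF ltnS ki nth_take.
have dropF' k : i < k -> drop k F' = drop k.+1 F.
  move=> ik; rewrite drop_cat sizetF ltnNge ik /= drop_drop.
  by congr drop; lia.
have takew' : take i.+1 w' = take i.+1 w by rewrite take_cat sizetw ltnn subnn cats0.
have dropw' : drop i.+1 w' = [:: false, nth false w i.+1 & drop i.+2 w].
  by rewrite drop_cat sizetw ltnn subnn drop0 (drop_nth false sizew).
have lastF' : fragment_tail (drop (size F').-1 F').
  rewrite dropF' sizeF' ?prednK //; last by lia.
  by rewrite -subn1 subn_gt0.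
(* Columns lie on both sides of the cross, so neither length is 1. *)
have reachF' : reach F' w i = reach F w' i.
  by apply: eq_reach => //; rewrite sizeF'; lia.
have cons : consistent (nth false w i) (reach F w' i).
  by rewrite -reachF'; apply: consistent_reach; apply: ltnW.
have -> : w \in weights F' = accepts (col F i.+2)
    (step (col F i) (col F i.+2) (nth false w i.+1) (reach F w' i))
    (drop i.+3 F) (drop i.+2 w).
  have swF' : size w = size F' by lia.
  have iF' : i < size F' by lia.
  by rewrite (mem_weightsE lastF' swF' iF')
    dropF' // dropF reachF' colF' // (drop_nth false sizew).
have -> : w' \in weights F = accepts (col F i.+2)
    (step (col F i.+1) (col F i.+2) (nth false w i.+1)
      (step (col F i) (col F i.+1) false (reach F w' i)))
    (drop i.+3 F) (drop i.+2 w).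
  by rewrite (mem_weightsE lastF sizew' (ltnW iF)) dropw' (drop_nth (Sym0, Sym0) iF) dropF.
have [[wi wi1]|ne] := eqVneq (nth false w i, nth false w i.+1) (delta F i, true).
  rewrite wi1 (step_exceptional _ cons wi) accepts_stuck.
  by split=> // -[_ []]; rewrite wi.
rewrite (accepts_agree _ tailF (t := step (col F i.+1) (col F i.+2)
  (nth false w i.+1) (step (col F i) (col F i.+1) false (reach F w' i)))).
  by split=> [->|[]//]; split=> //; apply/eqP.
by rewrite -domF; apply: step_skip_cross colF cons _; apply/eqP.
Qed.
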